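(* Let $\mathcal{A}$ be a condensed $m\times n$ sign pattern with $\operatorname{mr}(\mathcal{A})=3$. If each column of $\mathcal{A}$ contains at most $2$ zero entries, then $\operatorname{mr}_{\mathbb{Q}}(\mathcal{A})=3$.
   Context: A sign pattern is a matrix with entries in $\{+,-,0\}$; for a real matrix $B$, $\operatorname{sgn}(B)$ replaces positive/negative/zero entries by $+,-,0$; $Q(\mathcal{A})=\{A\text{ real}:\operatorname{sgn}(A)=\mathcal{A}\}$. The minimum rank $\operatorname{mr}(\mathcal{A})$ (resp. rational minimum rank $\operatorname{mr}_{\mathbb{Q}}(\mathcal{A})$) is the minimum rank of a real (resp. rational) matrix in $Q(\mathcal{A})$. A sign pattern is condensed if it has no zero row or zero column and no two rows (and no two columns) are identical or negatives of each other. *)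

(* Defs.v *)
From HB Require Import structures.
From mathcomp Require Import all_boot all_order all_algebra.
From mathcomp Require Import boolp reals.

Set Implicit Arguments.
Unset Strict Implicit.
Unset Printing Implicit Defensive.

Import Order.TTheory GRing.Theory Num.Theory.
Local Open Scope ring_scope.

Variant sign := Pos | Neg | Zero.

Definition sign_code (s : sign) : option bool :=
  match s with Pos => Some true | Neg => Some false | Zero => None end.

Definition sign_decode (o : option bool) : sign :=
  match o with Some true => Pos | Some false => Neg | None => Zero end.

Lemma sign_codeK : cancel sign_code sign_decode.
Proof. by case. Qed.

HB.instance Definition _ := Finite.copy sign (can_type sign_codeK).

Definition oppsign (s : sign) : sign :=
  match s with Pos => Neg | Neg => Pos | Zero => Zero end.

Definition sgn_of (F : realFieldType) (x : F) : sign :=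
  if 0 < x then Pos else if x < 0 then Neg else Zero.

Definition sgn_mx (F : realFieldType) (m n : nat) (B : 'M[F]_(m, n)) :
  'M[sign]_(m, n) := map_mx (@sgn_of F) B.

Definition qual_class (F : realFieldType) (m n : nat) (A : 'M[sign]_(m, n))
  (B : 'M[F]_(m, n)) : Prop := sgn_mx B = A.

Definition rank_attained (F : realFieldType) (m n : nat)
    (A : 'M[sign]_(m, n)) (r : nat) : Prop :=
  exists B : 'M[F]_(m, n), qual_class A B /\ \rank B = r.

Lemma rank_attained_ex (F : realFieldType) (m n : nat) (A : 'M[sign]_(m, n)) :
  exists r : nat, `[< rank_attained F A r >].
Proof.
pose v (s : sign) : F :=
  match s with Pos => 1 | Neg => -1 | Zero => 0 end.
exists (\rank (map_mx v A)); apply/asboolP; exists (map_mx v A); split=> //.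
apply/matrixP=> i j; rewrite !mxE /sgn_of.
by case: (A i j); rewrite /= ?ltr01 ?ltxx // oppr_gt0 oppr_lt0 ltr10 ltr01.
Qed.

Definition min_rank (F : realFieldType) (m n : nat) (A : 'M[sign]_(m, n)) : nat :=
  ex_minn (rank_attained_ex F A).

Definition mr (R : realType) (m n : nat) (A : 'M[sign]_(m, n)) : nat :=
  min_rank R A.

Definition mrQ (m n : nat) (A : 'M[sign]_(m, n)) : nat := min_rank rat A.

Definition condensed (m n : nat) (A : 'M[sign]_(m, n)) : Prop :=
  [/\ forall i : 'I_m, row i A <> const_mx Zero,
      forall j : 'I_n, col j A <> const_mx Zero,
      forall i1 i2 : 'I_m, i1 <> i2 ->
        row i1 A <> row i2 A /\ row i1 A <> map_mx oppsign (row i2 A)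
    & forall j1 j2 : 'I_n, j1 <> j2 ->
        col j1 A <> col j2 A /\ col j1 A <> map_mx oppsign (col j2 A)].

Definition col_zeros (m n : nat) (A : 'M[sign]_(m, n)) (j : 'I_n) : {set 'I_m} :=
  [set i | A i j == Zero].

(* Main.v *)
Require Import Defs.
From HB Require Import structures.
From mathcomp Require Import all_boot all_order all_algebra.
From mathcomp Require Import boolp reals.
From mathcomp Require Import ring.
From mathcomp Require Import classical_sets topology normedtype sequences.

Set Implicit Arguments.
Unset Strict Implicit.
Unset Printing Implicit Defensive.

(** Factor a real matrix of minimum rank as U V. Since the pattern is condensed,
    no two rows of U are proportional. Approximate the rows of U by arbitrary
    rational vectors and each column v of V by the orthogonal projection of a
    rational vector close to v onto the orthogonal complement of the (at most
    two) approximated rows u_i with u_i . v = 0. Cleared of denominators, the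
    projection is polynomial, and at the exact data it equals the Gram
    determinant of these rows times v; that determinant is positive because the
    rows are independent. So the zeros are kept exactly and the nonzero signs
    survive by continuity. *)

Section RationalApproximation.

Import Order.TTheory GRing.Theory Num.Theory numFieldNormedType.Exports.
Local Open Scope classical_set_scope.
Local Open Scope ring_scope.

(** * Dot products and division-free orthogonal projections over a commutative ring *)

Section DotProduct.
Variables (F : comNzRingType) (r : nat).
Implicit Types x y a b w : 'I_r -> F.

Definition dotf x y : F := \sum_i x i * y i.

Lemma dotfC x y : dotf x y = dotf y x.
Proof. by apply: eq_bigr => i _; rewrite mulrC. Qed.

Lemma dotfD x y z : dotf x (fun i => y i + z i) = dotf x y + dotf x z.
Proof. by rewrite -big_split; apply: eq_bigr => i _; rewrite mulrDr. Qed.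

Lemma dotfZ x c y : dotf x (fun i => c * y i) = c * dotf x y.
Proof. by rewrite mulr_sumr; apply: eq_bigr => i _; rewrite mulrCA. Qed.

Definition gram a b : F := dotf a a * dotf b b - dotf a b * dotf a b.

(** [dotf a a] times the projection of [w] onto the complement of [a]. The minus sign sits on the
    coefficient so that [dotfZ] applies; likewise in [proj2]. *)
Definition proj1 a w : 'I_r -> F :=
  fun i => dotf a a * w i + - dotf a w * a i.

(** The coefficients of [a] and [b] come from solving the 2 by 2 normal equations by Cramer's rule,
    then multiplying by the determinant [gram a b]. *)
Definition proj2 a b w : 'I_r -> F := fun i =>
  (gram a b * w i + - (dotf b b * dotf a w - dotf a b * dotf b w) * a i)
  + - (dotf a a * dotf b w - dotf a b * dotf a w) * b i.

Lemma dotf_proj1 x a w :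
  dotf x (proj1 a w) = dotf a a * dotf x w + - dotf a w * dotf x a.
Proof. by rewrite dotfD !dotfZ. Qed.

Lemma dotf_proj2 x a b w : dotf x (proj2 a b w) =
  (gram a b * dotf x w + - (dotf b b * dotf a w - dotf a b * dotf b w) * dotf x a)
  + - (dotf a a * dotf b w - dotf a b * dotf a w) * dotf x b.
Proof. by rewrite !dotfD !dotfZ. Qed.

Lemma proj1_orth a w : dotf a (proj1 a w) = 0.
Proof. by rewrite dotf_proj1; ring. Qed.

(** A polynomial identity, valid even for dependent [a] and [b]: zeros obtained from it are exact at
    every index, not just eventually. *)
Lemma proj2_orthl a b w : dotf a (proj2 a b w) = 0.
Proof. by rewrite dotf_proj2 /gram; ring. Qed.

Lemma proj2_orthr a b w : dotf b (proj2 a b w) = 0.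
Proof. by rewrite dotf_proj2 /gram (dotfC b a); ring. Qed.

End DotProduct.

(** * Positivity of the Gram determinant of two independent vectors *)

Section GramPositive.
Variables (F : realFieldType) (r : nat).
Implicit Types a b : 'I_r -> F.

Lemma dotf_ge0 a : 0 <= dotf a a.
Proof. by apply: sumr_ge0 => i _; rewrite -expr2 sqr_ge0. Qed.

Lemma dotf_eq0 a : dotf a a = 0 -> forall i, a i = 0.
Proof.
move=> /eqP; rewrite psumr_eq0 => [/allP h i|i _]; last by rewrite -expr2 sqr_ge0.
by have := h i (mem_index_enum _); rewrite /= mulf_eq0 orbb => /eqP.
Qed.

(** The vector [d] is [dotf b b] times the component of [a] orthogonal to [b]. Its squared norm is
    [dotf b b * gram a b], and it vanishes only if [a] is a multiple of [b]. *)
Lemma gram_gt0 a b : (exists i, b i <> 0) ->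
  (forall c, ~ forall i, a i = c * b i) -> 0 < gram a b.
Proof.
move=> [i0 bi0] nprop.
have bb : 0 < dotf b b.
  rewrite lt_neqAle dotf_ge0 andbT eq_sym; apply/eqP => /dotf_eq0 b0.
  exact: bi0 (b0 i0).
pose d i := dotf b b * a i + - dotf a b * b i.
have dd : dotf d d = dotf b b * gram a b.
  rewrite {2}/d dotfD !dotfZ (dotfC d a) (dotfC d b) !dotfD !dotfZ /gram.
  by rewrite (dotfC b a); ring.
rewrite -(pmulr_rgt0 _ bb) -dd lt_neqAle dotf_ge0 andbT eq_sym.
apply/eqP => /dotf_eq0 d0; apply: (nprop (dotf a b / dotf b b)) => i.
have := d0 i; rewrite /d => /eqP; rewrite mulNr subr_eq0 => /eqP e.
by rewrite mulrAC -e mulrAC divff ?mul1r // gt_eqF.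
Qed.

End GramPositive.

(** * Rational sequences with a real limit *)

Section Convergence.
Variable R : realType.

Definition cvgq (q : nat -> rat) (x : R) := ratr (q k) @[k --> \oo] --> x.

Lemma cvgqD p q x y : cvgq p x -> cvgq q y -> cvgq (fun k => p k + q k) (x + y).
Proof.
move=> hp hq; rewrite /cvgq; under eq_cvg do rewrite rmorphD /=.
exact: cvgD.
Qed.

Lemma cvgqM p q x y : cvgq p x -> cvgq q y -> cvgq (fun k => p k * q k) (x * y).
Proof.
move=> hp hq; rewrite /cvgq; under eq_cvg do rewrite rmorphM /=.
exact: cvgM.
Qed.

Lemma cvgqN p x : cvgq p x -> cvgq (fun k => - p k) (- x).
Proof.
move=> hp; rewrite /cvgq; under eq_cvg do rewrite rmorphN /=.
exact: cvgN.
Qed.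

Lemma cvgq_sum (I : Type) (s : seq I) (q : I -> nat -> rat) (x : I -> R) :
  (forall i, cvgq (q i) (x i)) ->
  cvgq (fun k => \sum_(i <- s) q i k) (\sum_(i <- s) x i).
Proof.
move=> h; elim: s => [|i s IHs].
  rewrite /cvgq; under eq_cvg do rewrite big_nil rmorph0.
  by rewrite big_nil; exact: cvg_cst.
rewrite /cvgq big_cons; under eq_cvg do rewrite big_cons.
exact: cvgqD.
Qed.

Lemma cvgq_approx (x : R) : exists q, cvgq q x.
Proof.
(* The error is bounded by the harmonic sequence, which tends to 0. *)
have h k : exists q : rat, `|x - ratr q| < (k.+1%:R)^-1 :> R.
  have e0 : 0 < (k.+1%:R)^-1 :> R by rewrite invr_gt0 ltr0n.
  have : x < x + (k.+1%:R)^-1 by rewrite ltrDl.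
  move=> /rat_in_itvoo[q]; rewrite in_itv /= => /andP[q1 q2].
  by exists q; rewrite distrC gtr0_norm ?subr_gt0 // ltrBlDl.
have [q hq] := choice h; exists q.
apply/cvgrPdist_lt => e e0.
have := @cvg_harmonic R; move=> /cvgrPdist_lt /(_ e e0).
apply: filterS => k; rewrite sub0r normrN ger0_norm ?harmonic_ge0 //.
exact: lt_trans (hq k).
Qed.

Lemma cvgq_sgn q (x : R) : x <> 0 -> cvgq q x ->
  \forall k \near \oo, sgn_of (q k) = sgn_of x.
Proof.
move=> x0 h; case: (ltgtP x 0) => // [xlt|xgt].
- near=> k; have : ratr (q k) < 0 :> R by near: k; exact: cvgr_lt h _ xlt.
  by rewrite ltrq0 /sgn_of xlt => qlt; rewrite qlt !ltNge !ltW.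
- near=> k; have : 0 < ratr (q k) :> R by near: k; exact: cvgr_gt h _ xgt.
  by rewrite ltr0q /sgn_of xgt => ->.
Unshelve. all: by end_near. Qed.

(** * Approximation of one column with prescribed zeros *)

Section Vectors.
Variable r : nat.
Implicit Types p q : nat -> 'I_r -> rat.
Implicit Types a b w x y : 'I_r -> R.

Definition cvgqv q x := forall i, cvgq (fun k => q k i) (x i).

Lemma cvgq_dotf p q x y : cvgqv p x -> cvgqv q y ->
  cvgq (fun k => dotf (p k) (q k)) (dotf x y).
Proof. by move=> hp hq; apply: cvgq_sum => i; exact: cvgqM. Qed.

Lemma cvgqv_proj1 qa qw a w : cvgqv qa a -> cvgqv qw w ->
  cvgqv (fun k => proj1 (qa k) (qw k)) (proj1 a w).
Proof.
move=> ha hw i; apply: cvgqD; apply: cvgqM => //; last apply: cvgqN;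
  exact: cvgq_dotf.
Qed.

Lemma cvgqv_proj2 qa qb qw a b w : cvgqv qa a -> cvgqv qb b -> cvgqv qw w ->
  cvgqv (fun k => proj2 (qa k) (qb k) (qw k)) (proj2 a b w).
Proof.
move=> ha hb hw i.
by do ![apply: cvgqD | apply: cvgqM | apply: cvgqN | apply: cvgq_dotf | done].
Qed.

(** The positive factor [c] absorbs the cleared denominator: it is a Gram determinant, a squared
    norm or 1 when [Z] has two, one or no elements. The sequence [Uq] is given in advance, so all
    columns can share it. *)
Lemma column_approx m (U : 'I_m -> 'I_r -> R) (Uq : 'I_m -> nat -> 'I_r -> rat)
    w (Z : {set 'I_m}) :
  (forall i, cvgqv (Uq i) (U i)) ->
  (forall i, exists k, U i k <> 0) ->
  (forall i1 i2 c, i1 <> i2 -> ~ forall k, U i1 k = c * U i2 k) ->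
  (forall i, i \in Z -> dotf (U i) w = 0) ->
  (#|Z| <= 2)%N ->
  exists (q : nat -> 'I_r -> rat) (c : R),
    [/\ 0 < c,
        forall k i, i \in Z -> dotf (Uq i k) (q k) = 0
      & forall i, cvgq (fun k => dotf (Uq i k) (q k)) (c * dotf (U i) w)].
Proof.
move=> hU U0 Uprop Zw Z2.
have [qw hw] : exists q, cvgqv q w.
  have [q hq] := choice (fun i => cvgq_approx (w i)).
  by exists (fun k i => q i k) => i; exact: hq.
move: Z2; rewrite leq_eqVlt ltnS leq_eqVlt ltnS leqn0.
case/or3P.
- case/cards2P => a [b [ab eZ]].
  have aw : dotf (U a) w = 0 by apply: Zw; rewrite eZ !inE eqxx.
  have bw : dotf (U b) w = 0 by apply: Zw; rewrite eZ !inE eqxx orbT.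
  exists (fun k => proj2 (Uq a k) (Uq b k) (qw k)), (gram (U a) (U b)); split.
  + by apply: gram_gt0 => // c; apply: Uprop; apply/eqP.
  + move=> k i; rewrite eZ !inE => /orP[] /eqP ->; first exact: proj2_orthl.
    exact: proj2_orthr.
  + move=> i; have -> : gram (U a) (U b) * dotf (U i) w
      = dotf (U i) (proj2 (U a) (U b) w) by rewrite dotf_proj2 aw bw; ring.
    by apply: cvgq_dotf => //; exact: cvgqv_proj2.
- case/cards1P => a eZ.
  have aw : dotf (U a) w = 0 by apply: Zw; rewrite eZ inE.
  exists (fun k => proj1 (Uq a k) (qw k)), (dotf (U a) (U a)); split.
  + rewrite lt_neqAle dotf_ge0 andbT eq_sym; apply/eqP => /dotf_eq0 a0.
    by have [k] := U0 a; rewrite a0.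
  + by move=> k i; rewrite eZ inE => /eqP ->; exact: proj1_orth.
  + move=> i; have -> : dotf (U a) (U a) * dotf (U i) w
      = dotf (U i) (proj1 (U a) w) by rewrite dotf_proj1 aw; ring.
    by apply: cvgq_dotf => //; exact: cvgqv_proj1.
- rewrite cards_eq0 => /eqP ->; exists qw, 1; split => //.
  + by move=> k i; rewrite inE.
  + by move=> i; rewrite mul1r; exact: cvgq_dotf.
Qed.

End Vectors.
End Convergence.

(** * Signs, minimum rank and condensed patterns *)

Lemma sgn_of_eq0 (F : realFieldType) (x : F) : (sgn_of x == Zero) = (x == 0).
Proof. by rewrite /sgn_of; case: (ltgtP x 0) => // ->; rewrite ltxx. Qed.

Lemma sgn_ofM_gt0 (F : realFieldType) (c x : F) :
  0 < c -> sgn_of (c * x) = sgn_of x.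
Proof. by move=> c0; rewrite /sgn_of pmulr_rgt0 // pmulr_rlt0. Qed.

Lemma sgn_ofN (F : realFieldType) (x : F) : sgn_of (- x) = oppsign (sgn_of x).
Proof. by rewrite /sgn_of oppr_gt0 oppr_lt0; case: (ltgtP x 0). Qed.

Lemma sgn_of_ratr (R : realFieldType) (q : rat) : sgn_of (ratr q : R) = sgn_of q.
Proof. by rewrite /sgn_of ltr0q ltrq0. Qed.

Lemma min_rank_attained (F : realFieldType) m n (A : 'M[sign]_(m, n)) :
  rank_attained F A (min_rank F A).
Proof. by rewrite /min_rank; case: ex_minnP => r /asboolP. Qed.

Lemma min_rank_le (F : realFieldType) m n (A : 'M[sign]_(m, n)) (B : 'M[F]_(m, n)) :
  qual_class A B -> (min_rank F A <= \rank B)%N.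
Proof.
move=> hB; rewrite /min_rank; case: ex_minnP => r _; apply.
by apply/asboolP; exists B.
Qed.

(** Embedding a rational matrix into the reals preserves both its rank and its signs. *)
Lemma mr_le_mrQ (R : realType) m n (A : 'M[sign]_(m, n)) : (mr R A <= mrQ A)%N.
Proof.
have [B [hB rB]] := min_rank_attained rat A.
rewrite /mrQ -rB -(mxrank_map (@ratr R) B); apply: min_rank_le.
rewrite /qual_class -hB; apply/matrixP => i j; rewrite !mxE.
exact: sgn_of_ratr.
Qed.

Lemma rank_factor (F : fieldType) m n r (B : 'M[F]_(m, n)) : \rank B = r ->
  exists (U : 'M_(m, r)) (V : 'M_(r, n)), B = U *m V.
Proof. by move=> <-; exists (col_base B), (row_base B); rewrite mulmx_base. Qed.

(** According to the sign of [c], proportional rows of [B] would give opposite rows, equal rows or a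
    zero row of [A]. *)
Lemma condensed_not_proportional (F : realFieldType) m n (A : 'M[sign]_(m, n))
    (B : 'M[F]_(m, n)) i1 i2 (c : F) :
  condensed A -> qual_class A B -> i1 <> i2 ->
  ~ forall j, B i1 j = c * B i2 j.
Proof.
move=> [hz _ hr _] hB ne h; have [h1 h2] := hr _ _ ne.
case: (ltgtP c 0) => [cn|cp|c0].
- apply: h2; apply/rowP => j; rewrite -hB !mxE h -sgn_ofN.
  by rewrite -(sgn_ofM_gt0 (- B i2 j) (c := - c)) ?oppr_gt0 // mulrNN.
- by apply: h1; apply/rowP => j; rewrite -hB !mxE h sgn_ofM_gt0.
- apply: (hz i1); apply/rowP => j; rewrite -hB !mxE h c0 mul0r.
  by rewrite /sgn_of ltxx.
Qed.

(** * Assembling the rational matrix *)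

Lemma mrQ_le_mr (R : realType) m n (A : 'M[sign]_(m, n)) :
  condensed A -> (forall j, (#|col_zeros A j| <= 2)%N) -> (mrQ A <= mr R A)%N.
Proof.
move=> hA hZ; have [B [hB rB]] := min_rank_attained R A.
have [U [V eB]] := rank_factor rB.
have BE i j : B i j = dotf (U i) (V ^~ j) by rewrite eB mxE.
have AE i j : A i j = sgn_of (B i j) by rewrite -hB mxE.
(* A zero row of [U] would make a zero row of [A]. *)
have U0 i : exists k, U i k <> 0.
  apply: contrapT => h; case: hA => + _ _ _ => /(_ i); apply.
  apply/rowP => j; rewrite !mxE AE BE /dotf big1 ?/sgn_of ?ltxx // => k _.
  by rewrite (_ : U i k = 0) ?mul0r //; apply: contrapT => h'; apply: h; exists k.
have Uprop i1 i2 c : i1 <> i2 -> ~ forall k, U i1 k = c * U i2 k.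
  move=> ne h; apply: (condensed_not_proportional (c := c) hA hB ne) => j.
  by rewrite !BE /dotf mulr_sumr; apply: eq_bigr => k _; rewrite h mulrA.
have [Uq hU] : exists Uq : 'I_m -> nat -> 'I_(mr R A) -> rat,
    forall i, cvgqv (Uq i) (U i).
  have [q hq] := choice (fun ik : 'I_m * 'I_(mr R A) => cvgq_approx (U ik.1 ik.2)).
  by exists (fun i l k => q (i, k) l) => i k; exact: (hq (i, k)).
have Zw j i : i \in col_zeros A j -> dotf (U i) (V ^~ j) = 0.
  by rewrite inE AE sgn_of_eq0 BE => /eqP.
have [Vq hV] := choice (fun j => column_approx hU U0 Uprop (Zw j) (hZ j)).
(* There are finitely many entries, so one index [k] is good for all of them: zero entries are
   correct at every index, nonzero ones eventually. *)
have [k hk] : exists k, forall ij : 'I_m * 'I_n,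
    sgn_of (dotf (Uq ij.1 k) (Vq ij.2 k)) = A ij.1 ij.2.
  suff /filter_ex [k hk] : \forall k \near \oo, forall ij : 'I_m * 'I_n,
    sgn_of (dotf (Uq ij.1 k) (Vq ij.2 k)) = A ij.1 ij.2 by exists k.
  apply: filter_forall => -[i j] /=; have [c [c0 h0 hc]] := hV j.
  have [ijZ|ijZ] := boolP (i \in col_zeros A j).
    apply: nearW => k; rewrite h0 //; move: ijZ; rewrite inE => /eqP ->.
    by rewrite /sgn_of ltxx.
  rewrite AE BE -(sgn_ofM_gt0 _ c0); apply: cvgq_sgn (hc i).
  apply/eqP; rewrite mulf_eq0 gt_eqF //=.
  by move: ijZ; rewrite inE AE sgn_of_eq0 BE.
pose Uk := \matrix_(i, l) Uq i k l; pose Vk := \matrix_(l, j) Vq j k l.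
have hQ : qual_class A (Uk *m Vk).
  apply/matrixP => i j; rewrite -(hk (i, j)) !mxE; congr sgn_of.
  by apply: eq_bigr => l _; rewrite !mxE.
(* The inner dimension of the product is [mr R A], which bounds its rank. *)
apply: leq_trans (min_rank_le hQ) _.
exact: mulmx_max_rank.
Qed.

End RationalApproximation.

Theorem theorem3p1 (R : realType) (m n : nat) (A : 'M[sign]_(m, n))
    (hcond : condensed A) (hmr : mr R A = 3)
    (hzeros : forall j : 'I_n, #|col_zeros A j| <= 2) :
  mrQ A = 3.
Proof.
by apply/eqP; rewrite -hmr eqn_leq mrQ_le_mr ?mr_le_mrQ.
Qed.
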